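(* The triakis tetrahedron and the pentagonal icositetrahedron are both Rupert. That is, for each $P\in\{P_{TT},P_{PI}\}$ (the two convex polyhedra in $\mathbb{R}^3$ defined in the context) there exist $\theta_p,\theta_q\in[0,2\pi)$, $\phi_p,\phi_q\in[0,\pi]$, $\alpha\in\mathbb{R}$ and $(u,v)\in\mathbb{R}^2$ such that $$\left(T_{u,v}\circ R_\alpha\circ M_{\theta_p,\phi_p}\right)(P)\subset \mathrm{int}\left(M_{\theta_q,\phi_q}(P)\right).$$
   Context: Informally, a convex polyhedron is Rupert if one can cut a hole in it and thread an identical copy of the polyhedron through the hole. Precisely: polyhedra are convex, compact and have nonempty interior. For $\theta,\phi\in\mathbb{R}$ let $M_{\theta,\phi}:\mathbb{R}^3\to\mathbb{R}^2$ be the linear map with matrix $$M_{\theta,\phi}=\begin{pmatrix}-\sin\theta&\cos\theta&0\\-\cos\theta\cos\phi&-\sin\theta\cos\phi&\sin\phi\end{pmatrix}$$ (orthogonal projection onto the plane orthogonal to $(\cos\theta\sin\phi,\sin\theta\sin\phi,\cos\phi)$, in an orthonormal basis of that plane). Let $R_\alpha=\begin{pmatrix}\cos\alpha&-\sin\alpha\\\sin\alpha&\cos\alpha\end{pmatrix}$ be rotation by $\alpha$ in $\mathbb{R}^2$, and $T_{u,v}(x,y)=(x+u,y+v)$. All maps act elementwise on sets, and $\mathrm{int}$ denotes interior in $\mathbb{R}^2$. A convex polyhedron $P\subset\mathbb{R}^3$ is Rupert if there are angles $\theta_p,\theta_q\in[0,2\pi)$, $\phi_p,\phi_q\in[0,\pi]$,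 $\alpha\in\mathbb{R}$ and a translation $(u,v)\in\mathbb{R}^2$ with $(T_{u,v}\circ R_\alpha\circ M_{\theta_p,\phi_p})(P)\subset\mathrm{int}(M_{\theta_q,\phi_q}(P))$. This property is invariant under similarities of $\mathbb{R}^3$ applied to $P$ (including reflections), so the scale, position and chirality of $P$ do not matter. The triakis tetrahedron and the pentagonal icositetrahedron are the Catalan solids dual to the truncated tetrahedron and the snub cube, respectively. For a finite set $V\subset\mathbb{R}^3$ write $V^\circ=\{x\in\mathbb{R}^3:\langle x,w\rangle\le 1\text{ for all }w\in V\}$. Triakis tetrahedron: $P_{TT}=V^\circ$, where $V$ is the set of the 12 vertices of a truncated tetrahedron, namely all permutations of $(\pm1,\pm1,\pm3)$ having an even number of minus signs. Pentagonal icositetrahedron: $P_{PI}=W^\circ$, where $W$ is the set of the 24 vertices of a snub cube, namely all even permutations of $(\pm1,\pm1/t,\pm t)$ with an even number of plus signs together with all odd permutations of $(\pm1,\pm1/t,\pm t)$ with an odd number of plus signs; here $t\approx1.839$ is the real root of $t^3=t^2+t+1$. *)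

(* Defs.v *)
(* Stdlib reals, with the topology of R * R taken from Coquelicot. *)
From Stdlib Require Import Reals Lra Psatz Bool Arith.
From Coquelicot Require Import Coquelicot.
Open Scope R_scope.

Definition R2 : Type := (R * R)%type.
Definition R3 : Type := (R * R * R)%type.

Definition inner (x w : R3) : R :=
  let '(x1, x2, x3) := x in
  let '(w1, w2, w3) := w in
  x1 * w1 + x2 * w2 + x3 * w3.

Definition polar (V : R3 -> Prop) (x : R3) : Prop :=
  forall w : R3, V w -> inner x w <= 1.

Definition image {A B : Type} (f : A -> B) (S : A -> Prop) (y : B) : Prop :=
  exists x : A, S x /\ f x = y.

Definition subset {A : Type} (S T : A -> Prop) : Prop :=
  forall x : A, S x -> T x.

(* [locally] is the neighbourhood filter of the product uniform structure
   (sup-norm balls), i.e. of the usual topology of the plane. *)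
Definition interior_plane (S : R2 -> Prop) (y : R2) : Prop := locally y S.

Definition proj (theta phi : R) (p : R3) : R2 :=
  let '(x, y, z) := p in
  (- sin theta * x + cos theta * y + 0 * z,
   - cos theta * cos phi * x + - sin theta * cos phi * y + sin phi * z).

Definition rot (alpha : R) (p : R2) : R2 :=
  let '(x, y) := p in
  (cos alpha * x - sin alpha * y, sin alpha * x + cos alpha * y).

Definition transl (u v : R) (p : R2) : R2 :=
  let '(x, y) := p in (x + u, y + v).

Definition Rupert (P : R3 -> Prop) : Prop :=
  exists theta_p theta_q phi_p phi_q alpha u v : R,
    0 <= theta_p < 2 * PI /\ 0 <= theta_q < 2 * PI /\
    0 <= phi_p <= PI /\ 0 <= phi_q <= PI /\
    subset (image (fun p => transl u v (rot alpha (proj theta_p phi_p p))) P)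
           (interior_plane (image (proj theta_q phi_q) P)).

(* In a triple of signs, [true] stands for plus and [false] for minus. *)
Definition sgn (b : bool) : R := if b then 1 else -1.

Definition nb_plus (a b c : bool) : nat :=
  (Nat.b2n a + Nat.b2n b + Nat.b2n c)%nat.

Definition nb_minus (a b c : bool) : nat :=
  nb_plus (negb a) (negb b) (negb c).

(* The even permutations of three letters are the cyclic ones; the odd ones
   are the three transpositions. *)
Definition even_perm (x y z : R) (w : R3) : Prop :=
  w = (x, y, z) \/ w = (y, z, x) \/ w = (z, x, y).

Definition odd_perm (x y z : R) (w : R3) : Prop :=
  w = (y, x, z) \/ w = (x, z, y) \/ w = (z, y, x).

Definition truncated_tetrahedron_vertex (w : R3) : Prop :=
  exists a b c : bool,
    Nat.Even (nb_minus a b c) /\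
    (even_perm (sgn a * 1) (sgn b * 1) (sgn c * 3) w \/
     odd_perm (sgn a * 1) (sgn b * 1) (sgn c * 3) w).

Definition P_TT : R3 -> Prop := polar truncated_tetrahedron_vertex.

Lemma tribonacci_sig : {t : R | t ^ 3 = t ^ 2 + t + 1}.
Proof.
destruct (IVT (fun t => t ^ 3 - t ^ 2 - t - 1) 1 2) as [t [_ Ht]].
- unfold continuity; intros x; apply derivable_continuous_pt; reg.
- lra.
- lra.
- lra.
- exists t; lra.
Qed.

(* The real root of t^3 = t^2 + t + 1; it is unique by the lemma below. *)
Definition tribonacci : R := proj1_sig tribonacci_sig.

Lemma tribonacciE (t : R) : t ^ 3 = t ^ 2 + t + 1 <-> t = tribonacci.
Proof.
assert (pos : forall x : R, x ^ 3 = x ^ 2 + x + 1 -> 1 < x).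
{ intros x Hx; destruct (Rle_or_lt x 1) as [H|H]; [exfalso|exact H].
  assert (E : (x - 1) * (x - 1) * (x + 1) = 2) by nra.
  assert (0 < x + 1) by nra.
  nra. }
split; intros H.
- unfold tribonacci; destruct tribonacci_sig as [s Hs]; simpl.
  assert (H1 := pos _ H); assert (H2 := pos _ Hs).
  assert (E : (t - s) * (t ^ 2 + t * s + s ^ 2 - t - s - 1) = 0) by nra.
  apply Rmult_integral in E; destruct E as [E|E]; nra.
- rewrite H; unfold tribonacci; exact (proj2_sig tribonacci_sig).
Qed.

Definition snub_cube_vertex (w : R3) : Prop :=
  let t := tribonacci in
  exists a b c : bool,
    (Nat.Even (nb_plus a b c) /\
     even_perm (sgn a * 1) (sgn b * (1 / t)) (sgn c * t) w) \/
    (Nat.Odd (nb_plus a b c) /\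
     odd_perm (sgn a * 1) (sgn b * (1 / t)) (sgn c * t) w).

Definition P_PI : R3 -> Prop := polar snub_cube_vertex.

(* Main.v *)
Require Import Defs.
From Stdlib Require Import Reals Lra Lia.
From Coquelicot Require Import Coquelicot.
From Stdlib Require Import List.
Import ListNotations.
Open Scope R_scope.

(** Each half is witnessed by one explicit pair of views with rational sines
    and cosines, and what has to be checked is that one shadow of the solid
    lies strictly inside another.

    The outer shadow is bounded from within by a polygon: finitely many points
    of the solid are projected, and a point of the plane strictly to the left
    of every edge of the closed polygon lies in their convex hull
    ([convex_fan]).  Being strictly left of finitely many lines is an open
    condition, so such a point is interior to the shadow
    ([polygon_interior]).  The inner shadow is bounded from without by
    duality: a point [x] of the polar of [V] is known through the inequalities
    [inner x w <= 1] for [w] in [V], and for each edge of the outer polygon the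
    signed area which must be positive is an affine function of [x].  Its
    positivity is therefore a linear consequence of those inequalities, by
    Farkas' lemma.  [polygon_rupert] puts the two sides together.

    For the triakis tetrahedron all data are rational.  For the pentagonal
    icositetrahedron the tribonacci constant is enclosed in a short interval,
    the solid is replaced from without by a slightly larger polyhedron with
    rational faces ([P_PI_rational_halfspaces]), and the outer polygon uses
    rational points slightly inside the solid.  The angles come from numerical
    maximisation of the ratio between the two shadows, followed by rounding.
    This is tight for the triakis tetrahedron: its inner shadow fits with a
    relative margin of about two millionths. *)

(** * Polygons in the plane *)

(** Stated with three points, as needed for triangles, which avoids the
    divisions of the two-point form. *)
Definition convex (S : R2 -> Prop) : Prop :=
  forall (p q r : R2) (a b c : R),
    S p -> S q -> S r -> 0 <= a -> 0 <= b -> 0 <= c -> a + b + c = 1 ->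
    S (a * fst p + b * fst q + c * fst r, a * snd p + b * snd q + c * snd r).

(** Twice the signed area of the triangle [a b y]; it is positive when [y] is
    strictly to the left of the line directed from [a] to [b]. *)
Definition orient (a b y : R2) : R :=
  (fst b - fst a) * (snd y - snd a) - (snd b - snd a) * (fst y - fst a).

Fixpoint left_of_path (a : R2) (l : list R2) (y : R2) : Prop :=
  match l with
  | [] => True
  | b :: l' => 0 < orient a b y /\ left_of_path b l' y
  end.

Lemma orient_flip (a b y : R2) : orient b a y = - orient a b y.
Proof. unfold orient; ring. Qed.

(** The barycentric coordinates of [y] in the triangle [o a b] are the signed
    areas opposite to the vertices over their sum; that sum is positive because
    of the signs assumed here, so the triangle cannot be degenerate. *)
Lemma convex_triangle (S : R2 -> Prop) (o a b y : R2) :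
  convex S -> S o -> S a -> S b ->
  0 < orient o a y -> 0 < orient a b y -> orient o b y <= 0 -> S y.
Proof.
intros HS Ho Ha Hb H1 H2 H3.
set (D := orient o a y + orient a b y - orient o b y).
assert (HD : 0 < D) by (unfold D; lra).
assert (E : y = (orient a b y / D * fst o + (- orient o b y) / D * fst a
                   + orient o a y / D * fst b,
                 orient a b y / D * snd o + (- orient o b y) / D * snd a
                   + orient o a y / D * snd b)).
{ revert HD; unfold D, orient; destruct y as [y1 y2], o, a, b; simpl.
  intros HD; f_equal; field; lra. }
rewrite E; apply HS; trivial;
  try (apply Rmult_le_pos; [lra | now apply Rlt_le, Rinv_0_lt_compat]).
unfold D in *; field; lra.
Qed.

(** Rotate a ray from [o] through the successive vertices of the polygon.  The
    point [y] is to its left at the first vertex, and it is not to its left at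
    the last one because the polygon closes up at [o]; so there are consecutive
    vertices between which the side changes, and [y] lies in the triangle that
    they form with [o]. *)
Lemma convex_fan (S : R2 -> Prop) (o y : R2) (l : list R2) :
  convex S -> S o -> Forall S l ->
  forall a, S a -> 0 < orient o a y -> left_of_path a (l ++ [o]) y -> S y.
Proof.
intros HS Ho Hl; induction Hl as [|b l Hb _ IH]; intros a Ha Hoa; simpl.
- rewrite (orient_flip o a y); lra.
- intros [Hab Hp].
  destruct (Rlt_le_dec 0 (orient o b y)) as [H|H].
  + now apply (IH b).
  + now apply (convex_triangle S o a b).
Qed.

Lemma locally_orient (a b y : R2) :
  0 < orient a b y -> locally y (fun z : R2 => 0 < orient a b z).
Proof.
intros H.
assert (C : continuous (orient a b) y).
{ unfold orient.
  apply (continuous_minus (V := R_NormedModule)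
    (fun z : R2 => (fst b - fst a) * (snd z - snd a))
    (fun z : R2 => (snd b - snd a) * (fst z - fst a)));
  apply (continuous_scal_r (V := R_NormedModule));
  apply (continuous_minus (V := R_NormedModule));
  try apply continuous_const;
  [apply continuous_snd | apply continuous_fst]. }
exact (C _ (open_gt 0 _ H)).
Qed.

Lemma locally_left_of_path (l : list R2) :
  forall a y, left_of_path a l y -> locally y (left_of_path a l).
Proof.
induction l as [|b l IH]; intros a y; simpl.
- intros _; apply Hierarchy.filter_true.
- intros [H Hl]; apply filter_and; [now apply locally_orient | now apply IH].
Qed.

Lemma polygon_interior (S : R2 -> Prop) (o : R2) (l : list R2) (y : R2) :
  convex S -> S o -> Forall S l -> left_of_path o (l ++ [o]) y ->
  interior_plane S y.
Proof.
intros HS Ho Hl Hy.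
unfold interior_plane.
apply (filter_imp (left_of_path o (l ++ [o]))); [|now apply locally_left_of_path].
intros z; destruct Hl as [|a l Ha Hl]; simpl.
- unfold orient; lra.
- intros [Hz Hp]; now apply (convex_fan S o z l HS Ho Hl a).
Qed.

(** * Views of a polar body *)

Lemma convex_proj_polar (V : R3 -> Prop) (theta phi : R) :
  convex (image (proj theta phi) (polar V)).
Proof.
intros p q r a b c [x [Hx <-]] [y [Hy <-]] [z [Hz <-]] Ha Hb Hc Habc.
destruct x as [[x1 x2] x3], y as [[y1 y2] y3], z as [[z1 z2] z3].
exists (a * x1 + b * y1 + c * z1, a * x2 + b * y2 + c * z2,
        a * x3 + b * y3 + c * z3); split.
- intros [[w1 w2] w3] Hw.
  specialize (Hx _ Hw); specialize (Hy _ Hw); specialize (Hz _ Hw).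
  unfold inner in *.
  apply (Rmult_le_compat_l a) in Hx; trivial.
  apply (Rmult_le_compat_l b) in Hy; trivial.
  apply (Rmult_le_compat_l c) in Hz; trivial.
  lra.
- unfold proj; simpl; f_equal; ring.
Qed.

(** Cosine and sine of the angle whose half has tangent [m]: a rational [m]
    gives a rational point of the circle. *)
Definition cos_ht (m : R) : R := (1 - m ^ 2) / (1 + m ^ 2).
Definition sin_ht (m : R) : R := 2 * m / (1 + m ^ 2).

(** For [0 <= m] the angle lies in the upper half circle, which makes it
    admissible as a polar angle [phi]. *)
Lemma angle_of_half_tangent (m : R) :
  exists theta, 0 <= theta < 2 * PI /\ (0 <= m -> theta <= PI) /\
    cos theta = cos_ht m /\ sin theta = sin_ht m.
Proof.
assert (Hm : 0 < 1 + m ^ 2) by nra.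
assert (E : cos_ht m ^ 2 + sin_ht m ^ 2 = 1).
{ unfold cos_ht, sin_ht; field; lra. }
assert (Hc : -1 <= cos_ht m <= 1) by nra.
assert (Hpi := PI_RGT_0).
destruct (acos_bound (cos_ht m)) as [A1 A2].
assert (Hs : sin (acos (cos_ht m)) = Rabs (sin_ht m)).
{ rewrite sin_acos by trivial.
  rewrite <- sqrt_Rsqr_abs; f_equal; unfold Rsqr; lra. }
destruct (Rle_or_lt 0 m) as [H|H].
- exists (acos (cos_ht m)); repeat split; try lra.
  + now apply cos_acos.
  + rewrite Hs; apply Rabs_pos_eq; unfold sin_ht.
    apply Rmult_le_pos; [lra | now apply Rlt_le, Rinv_0_lt_compat].
- assert (Hn : sin_ht m < 0).
  { unfold sin_ht, Rdiv.
    assert (0 < / (1 + m ^ 2)) by now apply Rinv_0_lt_compat.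
    nra. }
  assert (acos (cos_ht m) <> 0).
  { intros K; rewrite K, sin_0 in Hs.
    rewrite Rabs_left in Hs by trivial; lra. }
  exists (2 * PI - acos (cos_ht m)); repeat split; try lra.
  + rewrite cos_minus, cos_2PI, sin_2PI, cos_acos by trivial; ring.
  + rewrite sin_minus, cos_2PI, sin_2PI, Hs, Rabs_left by trivial; ring.
Qed.

(** [proj] and [rot] with the cosines and sines of the angles as parameters,
    so that they compute on rational data. *)
Definition view (ct st cf sf : R) (p : R3) : R2 :=
  let '(x, y, z) := p in
  (- st * x + ct * y + 0 * z, - ct * cf * x + - st * cf * y + sf * z).

Definition view_ht (m n : R) : R3 -> R2 :=
  view (cos_ht m) (sin_ht m) (cos_ht n) (sin_ht n).

Definition turn_ht (m : R) (p : R2) : R2 :=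
  let '(x, y) := p in
  (cos_ht m * x - sin_ht m * y, sin_ht m * x + cos_ht m * y).

(** The certificate: half-angle tangents of all the angles, a translation, and
    points [o :: l] of the body whose outer views are the successive vertices,
    counterclockwise, of a polygon that contains the inner view. *)
Lemma polygon_rupert (V : R3 -> Prop) (mp np mq nq k u v : R)
    (o : R3) (l : list R3) :
  0 <= np -> 0 <= nq -> polar V o -> Forall (polar V) l ->
  (forall x, polar V x ->
    left_of_path (view_ht mq nq o) (map (view_ht mq nq) l ++ [view_ht mq nq o])
      (transl u v (turn_ht k (view_ht mp np x)))) ->
  Rupert (polar V).
Proof.
intros Hnp Hnq Ho Hl Hleft.
destruct (angle_of_half_tangent mp) as (tp & Htp & _ & Ctp & Stp).
destruct (angle_of_half_tangent mq) as (tq & Htq & _ & Ctq & Stq).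
destruct (angle_of_half_tangent np) as (fp & Hfp & Hfp' & Cfp & Sfp).
destruct (angle_of_half_tangent nq) as (fq & Hfq & Hfq' & Cfq & Sfq).
destruct (angle_of_half_tangent k) as (al & _ & _ & Cal & Sal).
exists tp, tq, fp, fq, al, u, v; repeat split; try tauto.
intros y [x [Hx <-]].
assert (Eq : forall p, proj tq fq p = view_ht mq nq p).
{ intros [[p1 p2] p3]; unfold proj; rewrite Ctq, Stq, Cfq, Sfq; reflexivity. }
assert (Ep : rot al (proj tp fp x) = turn_ht k (view_ht mp np x)).
{ destruct x as [[x1 x2] x3]; unfold proj, rot.
  rewrite Ctp, Stp, Cfp, Sfp, Cal, Sal; reflexivity. }
rewrite Ep.
apply (polygon_interior _ (view_ht mq nq o) (map (view_ht mq nq) l)).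
- apply convex_proj_polar.
- now exists o.
- apply Forall_map; revert Hl; apply Forall_impl; intros w Hw; now exists w.
- now apply Hleft.
Qed.

(** * Triakis tetrahedron *)

(** Both vertex sets are unions of orbits under cyclic permutation of the
    coordinates. *)
Definition cyclic_le (a b c r : R) (x : R3) : Prop :=
  inner x (a, b, c) <= r /\ inner x (b, c, a) <= r /\ inner x (c, a, b) <= r.

Lemma P_TT_halfspaces (x : R3) :
  P_TT x <-> cyclic_le 1 1 3 1 x /\ cyclic_le 1 (-1) (-3) 1 x /\
             cyclic_le (-1) 1 (-3) 1 x /\ cyclic_le (-1) (-1) 3 1 x.
Proof.
destruct x as [[x1 x2] x3]; unfold cyclic_le; split.
- intros H.
  assert (K : forall a b c, Nat.Even (nb_minus a b c) ->
    cyclic_le (sgn a * 1) (sgn b * 1) (sgn c * 3) 1 (x1, x2, x3)).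
  { intros a b c E; repeat split; apply H; exists a, b, c;
    unfold even_perm; tauto. }
  assert (K1 := K true true true ltac:(now exists 0%nat)).
  assert (K2 := K true false false ltac:(now exists 1%nat)).
  assert (K3 := K false true false ltac:(now exists 1%nat)).
  assert (K4 := K false false true ltac:(now exists 1%nat)).
  unfold cyclic_le in *; simpl in *; lra.
- intros H w (a & b & c & [n Hn] & Hw); unfold even_perm, odd_perm in Hw.
  destruct a, b, c; try (exfalso; unfold nb_minus, nb_plus in Hn; simpl in Hn; lia);
  destruct Hw as [[->|[->| ->]]|[->|[->| ->]]]; simpl in *; lra.
Qed.

(** The inner direction lies in the plane [y = 0], and the outer direction is
    close to the mirror plane [x = y] of the solid: [70/169] is a continued
    fraction convergent of the tangent of [PI/8].  The outer shadow
    is a pentagon, whose corners are the views of five vertices of the solid. *)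
Lemma rupert_TT : Rupert P_TT.
Proof.
apply (polygon_rupert _ 0 (123/284) (70/169) (61/62) 1 0 (-9/200000)
  (1/3, -1/3, 1/3)
  [(1/5, -1/5, -1/5); (1/3, 1/3, -1/3); (-1/5, 1/5, -1/5); (-1/3, 1/3, 1/3)]);
  try lra.
- apply P_TT_halfspaces; unfold cyclic_le; simpl; lra.
- repeat apply Forall_cons; try apply Forall_nil;
  apply P_TT_halfspaces; unfold cyclic_le; simpl; lra.
- intros [[x1 x2] x3] Hx; apply P_TT_halfspaces in Hx.
  unfold cyclic_le, inner in Hx.
  unfold view_ht, turn_ht, view, transl, cos_ht, sin_ht.
  simpl; unfold orient; simpl.
  repeat split; lra.
Qed.

(** * Pentagonal icositetrahedron *)

(** The polar of the snub cube with [s] and [t] in place of [1/t] and [t], and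
    scaled by [r].  In the second group the first two entries are exchanged,
    since the odd permutations of [(a, b, c)] are the cyclic ones of
    [(b, a, c)]. *)
Definition snub_halfspaces (s t r : R) (x : R3) : Prop :=
  (cyclic_le 1 s (- t) r x /\ cyclic_le 1 (- s) t r x /\
   cyclic_le (-1) s t r x /\ cyclic_le (-1) (- s) (- t) r x) /\
  (cyclic_le s 1 t r x /\ cyclic_le (- s) 1 (- t) r x /\
   cyclic_le s (-1) (- t) r x /\ cyclic_le (- s) (-1) t r x).

Lemma P_PI_halfspaces (x : R3) :
  P_PI x <-> snub_halfspaces (1 / tribonacci) tribonacci 1 x.
Proof.
destruct x as [[x1 x2] x3]; unfold snub_halfspaces; split.
- intros H.
  assert (K : forall a b c, Nat.Even (nb_plus a b c) ->
    cyclic_le (sgn a * 1) (sgn b * (1 / tribonacci)) (sgn c * tribonacci)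
      1 (x1, x2, x3)).
  { intros a b c E; repeat split; apply H; exists a, b, c; left; split;
    unfold even_perm; tauto. }
  assert (L : forall a b c, Nat.Odd (nb_plus a b c) ->
    cyclic_le (sgn b * (1 / tribonacci)) (sgn a * 1) (sgn c * tribonacci)
      1 (x1, x2, x3)).
  { intros a b c E; repeat split; apply H; exists a, b, c; right; split;
    unfold odd_perm; tauto. }
  assert (K1 := K true true false ltac:(now exists 1%nat)).
  assert (K2 := K true false true ltac:(now exists 1%nat)).
  assert (K3 := K false true true ltac:(now exists 1%nat)).
  assert (K4 := K false false false ltac:(now exists 0%nat)).
  assert (L1 := L true true true ltac:(now exists 1%nat)).
  assert (L2 := L true false false ltac:(now exists 0%nat)).
  assert (L3 := L false true false ltac:(now exists 0%nat)).
  assert (L4 := L false false true ltac:(now exists 0%nat)).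
  clear H K L; unfold cyclic_le in *; simpl in *; lra.
- intros H w (a & b & c & Hw); unfold even_perm, odd_perm in Hw.
  unfold cyclic_le in H; simpl in H.
  destruct Hw as [[[n Hn] Hw]|[[n Hn] Hw]];
  destruct a, b, c; try (exfalso; unfold nb_plus in Hn; simpl in Hn; lia);
  destruct Hw as [->|[->| ->]]; simpl; lra.
Qed.

Lemma tribonacci_bounds :
  1839286 / 1000000 < tribonacci < 1839287 / 1000000 /\
  543688 / 1000000 < 1 / tribonacci < 543690 / 1000000.
Proof.
assert (E : tribonacci ^ 3 = tribonacci ^ 2 + tribonacci + 1).
{ now apply tribonacciE. }
revert E; generalize tribonacci; intros t E.
(* The cubic is increasing past 18/10, in the form of a positive divided
   difference between [t] and [r]. *)
assert (M : forall r, 18 / 10 < r -> exists f, 0 < f /\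
  t ^ 3 - t ^ 2 - t - 1 - (r ^ 3 - r ^ 2 - r - 1) = (t - r) * f).
{ intros r Hr; exists (t ^ 2 + t * r + r ^ 2 - t - r - 1); split; [|ring].
  assert (0 <= (2 * t + r - 1) ^ 2) by apply pow2_ge_0; nra. }
assert (B : 1839286 / 1000000 < t < 1839287 / 1000000).
{ destruct (M (1839286 / 1000000) ltac:(lra)) as (f & Hf & Ef).
  destruct (M (1839287 / 1000000) ltac:(lra)) as (g & Hg & Eg).
  split; nra. }
split; trivial.
assert (F : t * (1 / t) = 1) by (field; lra).
split; nra.
Qed.

(** Pairs of the defining inequalities add up to [|t * x_i| <= 1], so the
    coordinates of [x] are at most one in absolute value, and moving [s] and
    [t] by [1/10^6] changes every left-hand side by at most [2/10^6]. *)
Lemma P_PI_rational_halfspaces (x : R3) :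
  P_PI x ->
  snub_halfspaces (543689 / 1000000) (1839287 / 1000000) (100001 / 100000) x.
Proof.
rewrite P_PI_halfspaces.
destruct tribonacci_bounds as [Ht Hs].
revert Ht Hs; generalize (1 / tribonacci); intros s;
generalize tribonacci; intros t Ht Hs.
destruct x as [[x1 x2] x3].
assert (A : forall z, - 1 <= t * z <= 1 ->
  Rabs ((s - 543689 / 1000000) * z) <= 1 / 1000000 /\
  Rabs ((t - 1839287 / 1000000) * z) <= 1 / 1000000).
{ intros z Hz.
  assert (Hz0 := Rabs_pos z).
  assert (Hz1 : Rabs z <= 1).
  { apply Rabs_le in Hz; rewrite Rabs_mult, (Rabs_pos_eq t) in Hz by lra.
    assert (0 <= (t - 1) * Rabs z) by (apply Rmult_le_pos; lra); lra. }
  rewrite !Rabs_mult; split;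
  (assert (Rabs (s - 543689 / 1000000) <= 1 / 1000000) by (apply Rabs_le; lra);
   assert (Rabs (t - 1839287 / 1000000) <= 1 / 1000000) by (apply Rabs_le; lra);
   nra). }
unfold snub_halfspaces, cyclic_le, inner; intros H.
assert (A1 := A x1 ltac:(lra)); assert (A2 := A x2 ltac:(lra));
assert (A3 := A x3 ltac:(lra)); clear A.
rewrite !Rabs_le_between in A1, A2, A3.
lra.
Qed.

(** The outer polygon is a dodecagon.  Its corners are the views of vertices of
    the solid truncated to four decimals towards the interior, which costs less
    than the room left between the two shadows, about [4/10^4]. *)
Lemma rupert_PI : Rupert P_PI.
Proof.
assert (HV : Forall P_PI
  [(0, -5436/10000, 0); (873/10000, -4088/10000, -2955/10000);
   (-873/10000, -2955/10000, -4088/10000); (0, 0, -5436/10000);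
   (873/10000, 2955/10000, -4088/10000); (-873/10000, 4088/10000, -2955/10000);
   (0, 5436/10000, 0); (873/10000, 4088/10000, 2955/10000);
   (-873/10000, 2955/10000, 4088/10000); (0, 0, 5436/10000);
   (873/10000, -2955/10000, 4088/10000); (-873/10000, -4088/10000, 2955/10000)]).
(* Membership is affine in [s] and [t], hence follows from their bounds. *)
{ destruct tribonacci_bounds as [Ht Hs].
  repeat apply Forall_cons; try apply Forall_nil;
  apply P_PI_halfspaces; unfold snub_halfspaces, cyclic_le; simpl; lra. }
apply Forall_cons_iff in HV; destruct HV as [Ho Hl].
apply (polygon_rupert _ (-2/35) (21/34) (1/24) (53/49) (-39/37) (7/10000)
  (-1/1000) _ _ ltac:(lra) ltac:(lra) Ho Hl).
intros [[x1 x2] x3] Hx; apply P_PI_rational_halfspaces in Hx.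
unfold snub_halfspaces, cyclic_le, inner in Hx.
unfold view_ht, turn_ht, view, transl, cos_ht, sin_ht.
simpl; unfold orient; simpl.
repeat split; lra.
Qed.

Theorem mainTheorem1 : Rupert P_TT /\ Rupert P_PI.
Proof.
split; [exact rupert_TT | exact rupert_PI].
Qed.
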